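(* Let $\mathbb{K}\in\{\mathbb{R},\mathbb{C}\}$, let $(\Omega,\Sigma,\mu)$ be a positive measure space and $V_n$ an $n$-dimensional subspace of $L_2(\Omega,\mu;\mathbb{K})$. Then there exist $N=\dim_{\mathbb{K}}\operatorname{lin}_{\mathbb{K}}\{f\,\overline{g}: f,g\in V_n\}$ points $x_1,\ldots,x_N\in\Omega$ together with associated non-negative weights $\mu_1,\ldots,\mu_N$ such that $$\int_\Omega f(x)\overline{g(x)}\,\mathrm{d}\mu(x)=\sum_{j=1}^N\mu_jf(x_j)\overline{g(x_j)}\quad\text{for all } f,g\in V_n.$$ In case $\mathbb{K}=\mathbb{R}$ we have $N\le\binom{n+1}{2}$; in case $\mathbb{K}=\mathbb{C}$ we have $N\le n^2$.
   Context: $\operatorname{lin}_{\mathbb{K}}$ denotes the $\mathbb{K}$-linear span. A positive measure is a classical measure with values in $[0,\infty]$. The space $V_n$ is assumed to consist of proper functions $\Omega\to\mathbb{K}$ with unambiguously defined values at each $x\in\Omega$ (if given as equivalence classes, one fixes representatives of a basis and takes the space of functions that is their $\mathbb{K}$-linear span); spans and dimensions are those of spaces of proper functions. *)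

(* Defs.v *)
From mathcomp Require Export all_boot all_order all_algebra.
From mathcomp Require Export complex.
From mathcomp Require Export all_classical all_reals all_analysis.

Set Implicit Arguments.
Unset Strict Implicit.
Unset Printing Implicit Defensive.

Import GRing.Theory Num.Theory.

Local Open Scope classical_set_scope.
Local Open Scope ring_scope.

Section linear_span.
Context (K : fieldType) (E : lmodType K).

Definition lin (A : set E) : set E :=
  [set v | exists m (a : 'I_m -> K) (u : 'I_m -> E),
     (forall i, A (u i)) /\ v = \sum_(i < m) a i *: u i].

Definition lin_indep (n : nat) (b : 'I_n -> E) : Prop :=
  forall a : 'I_n -> K, \sum_(i < n) a i *: b i = 0 -> forall i, a i = 0.

(* This includes that [V] is a linear subspace, being the span of a basis. *)
Definition subspace_of_dim (n : nat) (V : set E) : Prop :=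
  exists b : 'I_n -> E, lin_indep b /\ V = lin (range b).

End linear_span.

(* The library has no Borel structure on R[i]; measurability and integration
   of complex-valued functions are taken componentwise. *)
Section complex_valued_functions.
Context (R : realType) (d : measure_display) (T : measurableType d).
Variable mu : {measure set T -> \bar R}.

(* Complex counterpart of [Lfun mu 2%:E] (functions, not classes). *)
Definition complex_L2 (f : T -> R[i]) : Prop :=
  [/\ measurable_fun setT (fun x => complex.Re (f x)),
      measurable_fun setT (fun x => complex.Im (f x)) &
      finite_norm mu 2%:E (fun x => Normc.normc (f x))].

Definition complex_integral (h : T -> R[i]) : R[i] :=
  Complex (\int[mu]_x complex.Re (h x)) (\int[mu]_x complex.Im (h x)).

End complex_valued_functions.

(* Main.v *)
From mathcomp Require Import finmap ring measurable_realfun.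
Require Import Defs.

(** Write [U] for the span of the products [f * conj g].  It has a basis
    [u_1, ..., u_N] of real-valued integrable functions, also when the scalars
    are complex, since [U] is then stable under conjugation and is spanned by
    the real and imaginary parts of the products of basis functions of [V].  A
    quadrature formula on [U] expresses the vector of integrals
    [I = (int u_1, ..., int u_N)] as a nonnegative combination of values of
    the curve [u = (u_1, ..., u_N) : Omega -> R^N].

    So one has to see that [I] lies in the convex cone generated by [u(Omega)]
    ([integral_in_cone]).  This cone need not be closed, hence a point outside
    it can only be separated weakly ([conic_separation]): there is a nonzero
    functional [a] with [a . u >= 0] on [Omega] and [a . I <= 0].  Then the
    nonnegative function [a . u] has integral at most zero and vanishes off a
    null set.  Removing this set changes no integral, and on the rest of the
    space one of the [u_i] is a combination of the others, so an induction on
    the number of functions concludes.  The weak separation itself comes from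
    the Farkas lemma for finitely many vectors ([farkas]) and the compactness
    of the unit sphere.

    By Caratheodory's argument ([conic_row_free]) the points can be chosen with
    linearly independent values of [u], so there are at most [N] of them and
    they are distinct.  As the [u_i] are linearly independent, further points
    with independent values exist until there are exactly [N]; these receive
    the weight zero ([pad_conic]).  Together this gives [tchakaloff].

    The bounds on [N] count a spanning family: in the real case the products
    [f_i * f_j] with [i <= j]; in the complex case the real parts of
    [f_i * conj f_j] for [i <= j] and the imaginary parts for [j < i]. *)

Import Order.TTheory GRing.Theory Num.Theory.
Import numFieldNormedType.Exports.

Set Implicit Arguments.
Unset Strict Implicit.
Unset Printing Implicit Defensive.

Local Open Scope classical_set_scope.
Local Open Scope ring_scope.

(** * Linear spans *)

Section span.
Context (K : fieldType) (E : lmodType K).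
Implicit Types (A B : set E).

Lemma lin_id A v : A v -> lin A v.
Proof.
move=> Av; exists 1%N, (fun=> 1), (fun=> v); split=> //.
by rewrite big_ord1 scale1r.
Qed.

Lemma lin0 A : lin A 0.
Proof.
by exists 0%N, (fun=> 0), (fun=> 0); split=> [[]//|]; rewrite big_ord0.
Qed.

Lemma linZ A a v : lin A v -> lin A (a *: v).
Proof.
move=> [m [c [u [Au ->]]]]; exists m, (fun i => a * c i), u; split => //.
by rewrite scaler_sumr; apply: eq_bigr => i _; rewrite scalerA.
Qed.

Lemma linD A v w : lin A v -> lin A w -> lin A (v + w).
Proof.
move=> [m [a [u [Au ->]]]] [p [b [u' [Au' ->]]]].
exists (m + p)%N,
  (fun i => match fintype.split i with inl j => a j | inr j => b j end),
  (fun i => match fintype.split i with inl j => u j | inr j => u' j end); split.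
  by move=> i; case: fintype.split.
rewrite big_split_ord; congr (_ + _); apply: eq_bigr => i _.
  by rewrite (unsplitK (inl i)).
by rewrite (unsplitK (inr i)).
Qed.

Lemma lin_sum A n (a : 'I_n -> K) (v : 'I_n -> E) :
  (forall i, lin A (v i)) -> lin A (\sum_(i < n) a i *: v i).
Proof.
move=> Av; elim/big_ind: _ => [|x y|i _]; first exact: lin0.
  exact: linD.
exact: linZ.
Qed.

Lemma sub_lin A B : A `<=` lin B -> lin A `<=` lin B.
Proof.
by move=> AB v [m [a [u [Au ->]]]]; apply: lin_sum => i; exact/AB/Au.
Qed.

Lemma lin_rangeP n (b : 'I_n -> E) v :
  lin (range b) v <-> exists a : 'I_n -> K, v = \sum_(i < n) a i *: b i.
Proof.
split=> [[m [c [u [bu ->]]]]|[a ->]]; last first.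
  by apply: lin_sum => i; apply: lin_id; exists i.
elim/big_ind: _ => [|x y [a ->] [a' ->]|i _].
- by exists (fun=> 0); rewrite big1// => i _; rewrite scale0r.
- exists (a \+ a'); rewrite -big_split; apply: eq_bigr => i _ /=.
  by rewrite scalerDl.
- have [j _ <-] := bu i; exists (fun k => if k == j then c i else 0).
  rewrite (bigD1 j)//= eqxx big1 ?addr0// => k kj.
  by rewrite (negbTE kj) scale0r.
Qed.

(** Keeping the basis vectors inside [s] matters: they inherit whatever is known
    of the elements of [s], such as integrability. *)
Lemma exists_basis (s : seq E) : exists n (b : 'I_n -> E),
  [/\ (n <= size s)%N, lin_indep b, forall i, b i \in s &
      forall v, v \in s -> lin (range b) v].
Proof.
elim: s => [|v s [n [b [ns ib bs sb]]]].
  by exists 0%N, (fun=> 0); split => // [a _ []|[]].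
have [vb|vb] := pselect (lin (range b) v).
  exists n, b; split => //; first exact: leqW.
    by move=> i; rewrite inE bs orbT.
  by move=> w; rewrite inE => /predU1P[->//|/sb].
pose b' (i : 'I_n.+1) := if unlift ord0 i is Some j then b j else v.
have b'0 : b' ord0 = v by rewrite /b' unlift_none.
have b'S i : b' (lift ord0 i) = b i by rewrite /b' liftK.
have bb' : range b `<=` range b' by move=> _ [i _ <-]; exists (lift ord0 i).
exists n.+1, b'; split => //.
- move=> a; rewrite big_ord_recl b'0; under eq_bigr do rewrite b'S.
  move=> a0; have av : a ord0 = 0.
    apply/eqP; apply: contrapT => /negP a00; apply: vb; apply/lin_rangeP.
    exists (fun i => - (a ord0)^-1 * a (lift ord0 i)).
    under eq_bigr do rewrite -scalerA.
    rewrite -scaler_sumr; move/eqP: a0; rewrite addrC addr_eq0 => /eqP ->.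
    by rewrite scalerN scaleNr opprK scalerA mulVf// scale1r.
  move: a0; rewrite av scale0r add0r => /ib a0 i.
  by case: (unliftP ord0 i) => [j|] ->.
- move=> i; case: (unliftP ord0 i) => [j|] ->.
    by rewrite b'S inE bs orbT.
  by rewrite b'0 inE eqxx.
- move=> w; rewrite inE => /predU1P[->|/sb].
    by apply: lin_id; exists ord0.
  by apply: sub_lin => z /bb'; exact: lin_id.
Qed.

End span.

(** The twist [s] covers both fields at once: it is the identity for real
    scalars and the conjugation for complex ones. *)
Lemma mul_span (K : fieldType) (T : Type) (s : {rmorphism K -> K}) n
    (f : 'I_n -> T -> K^o) (A : set (T -> K^o)) :
  (forall i j, lin A (fun t => f i t * s (f j t))) ->
  forall g h, lin (range f) g -> lin (range f) h ->
    lin A (fun t => g t * s (h t)).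
Proof.
move=> fA _ _ /lin_rangeP[a ->] /lin_rangeP[b ->].
pose pr i j : T -> K^o := fun t => f i t * s (f j t).
have -> : (fun t => (\sum_(i < n) a i *: f i) t *
                    s ((\sum_(i < n) b i *: f i) t)) =
    \sum_(i < n) a i *: (\sum_(j < n) s (b j) *: pr i j).
  apply/funext => t; rewrite !fct_sumE mulr_suml; apply: eq_bigr => i _.
  rewrite rmorph_sum mulr_sumr.
  rewrite -[RHS]/(a i * (\sum_(j < n) s (b j) *: pr i j) t).
  rewrite fct_sumE mulr_sumr; apply: eq_bigr => j _.
  rewrite -[LHS]/(a i * f i t * s (b j * f j t)).
  rewrite -[RHS]/(a i * (s (b j) * (f i t * s (f j t)))).
  by rewrite rmorphM -mulrA; congr (_ * _); rewrite mulrCA.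
by do 2 (apply: lin_sum => ?); exact: fA.
Qed.

(** * Finitely generated cones and separation *)

(** Induction on the number of vectors, the rows of [M].  If the functional [a]
    that works for all rows but the first, [v], is negative on [v], project
    everything along [v] onto the kernel of [a] and apply the induction
    hypothesis there: a conic combination of the projections lifts to one of the
    original vectors because [a] is negative on both [v] and [b] and nonnegative
    on the other rows, and a functional on the kernel of [a] extends by zero
    on [v]. *)
Lemma farkas (F : realFieldType) m n (M : 'M[F]_(m, n)) (b : 'rV[F]_n) :
  (exists2 c : 'rV[F]_m, (forall i, 0 <= c 0 i) & b = c *m M) \/
  (exists2 a : 'cV[F]_n, (forall i, 0 <= (M *m a) i 0) & (b *m a) 0 0 < 0).
Proof.
elim: m M b => [|m IH] M b.
  have [->|b0] := eqVneq b 0.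
    by left; exists 0 => [i|]; rewrite ?mxE ?mul0mx.
  (* Without vectors, the functional [- b] separates [b] from [0]. *)
  right; exists (- b^T); first by case.
  rewrite mulmxN mxE oppr_lt0 mxE lt_neqAle eq_sym andbC sumr_ge0/=; last first.
    by move=> i _; rewrite mxE -expr2 sqr_ge0.
  apply: contra b0; rewrite psumr_eq0 => [/allP b0|i _]; last first.
    by rewrite mxE -expr2 sqr_ge0.
  apply/eqP/rowP => i; have := b0 i (mem_index_enum _).
  by rewrite !mxE -expr2 sqrf_eq0 => /eqP.
rewrite -[m.+1]/(1 + m)%N in M *.
rewrite -(vsubmxK M); move: (usubmx M) (dsubmx M) => v {}M.
have [[c c0 ->]|[a Ma ba]] := IH M b.
  left; exists (row_mx 0 c); last by rewrite mul_row_col mul0mx add0r.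
  by move=> i; rewrite mxE; case: fintype.split => j; rewrite ?mxE.
pose s := (v *m a) 0 0.
have vaE : v *m a = s%:M by rewrite [LHS]mx11_scalar.
have [s0|s0] := leP 0 s.
  right; exists a => // i; rewrite mul_col_mx mxE.
  by case: fintype.split => j //; rewrite (ord1 j) vaE mxE.
have sn0 : s != 0 by rewrite lt_eqF.
have [[c c0 /eqP]|[a' Ma' ba']] :=
    IH (M - s^-1 *: (M *m a *m v)) (b - s^-1 *: (b *m a *m v)).
  rewrite subr_eq => /eqP bE; left.
  exists (row_mx (s^-1 *: (b *m a - c *m M *m a)) c).
    have cMa : 0 <= (c *m M *m a) 0 0.
      by rewrite -mulmxA mxE sumr_ge0// => k _; rewrite mulr_ge0.
    move=> i; rewrite mxE; case: fintype.split => j //; rewrite ord1 mxE.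
    rewrite nmulr_rge0 ?invr_lt0// mxE [X in _ + X]mxE subr_le0.
    exact: le_trans (ltW ba) cMa.
  rewrite mul_row_col {1}bE mulmxBr -scalemxAr -scalemxAl mulmxBl scalerBr.
  by rewrite !mulmxA addrC addrA addrAC -addrA.
(* [a2] is [a'] precomposed with the projection. *)
right; pose a2 := a' - s^-1 *: (a *m (v *m a')).
have proj p (X : 'M[F]_(p, n)) : X *m a2 = (X - s^-1 *: (X *m a *m v)) *m a'.
  by rewrite mulmxBr mulmxBl -scalemxAr -scalemxAl !mulmxA.
exists a2; last by rewrite proj.
move=> i; rewrite mul_col_mx mxE.
case: fintype.split => j; last by rewrite proj.
by rewrite proj vaE mul_scalar_mx scalerA mulVf// scale1r subrr mul0mx mxE.
Qed.

(** The convex cone generated by [h @` D].  Its elements are described by points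
    of [D] rather than by vectors, as these points become quadrature nodes. *)
Definition conic (R : realFieldType) (T : Type) n (D : set T)
    (h : T -> 'rV[R]_n) : set 'rV[R]_n :=
  [set b | exists m (x : 'I_m -> T) (c : 'rV[R]_m),
    [/\ forall i, D (x i), forall i, 0 <= c 0 i &
        b = c *m \matrix_(i < m) h (x i)]].

(** Suppose that no such functional exists.  Then each [a] in the unit sphere is
    negative on some [h x] with [x] in [D], or on [- b].  These are open
    conditions on [a], so by compactness finitely many of them cover the sphere,
    and the Farkas lemma for the corresponding finitely many [h x] exhibits [b]
    in the cone. *)
Lemma conic_separation (R : realType) (T : Type) n (D : set T)
    (h : T -> 'rV[R]_n) (b : 'rV[R]_n) : ~ conic D h b ->
  exists a : 'cV[R]_n,
    [/\ a != 0, forall x, D x -> 0 <= (h x *m a) 0 0 & (b *m a) 0 0 <= 0].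
Proof.
move=> nb; apply: contrapT => noa.
have pairing_continuous (v : 'rV[R]_n) :
    continuous (fun a : 'rV[R]_n => (v *m a^T) 0 0).
  have -> : (fun a : 'rV[R]_n => (v *m a^T) 0 0) =
            (fun a => \sum_(i < n) v 0 i * a 0 i).
    by apply/funext => z; rewrite mxE; apply: eq_bigr => i _; rewrite mxE.
  apply: (@continuous_big R _ _ _ _ _ _ _
    (fun i (a : 'rV[R]_n) => v 0 i * a 0 i)).
    by move=> z; apply: (@cvgD R R^o); [exact: cvg_fst|exact: cvg_snd].
  move=> i _ a; apply: (@continuousM R 'rV[R]_n (fun=> v 0 i)).
    exact: cst_continuous.
  exact: coord_continuous.
pose S := [set a : 'rV[R]_n | `|a| = 1].
have cS : compact S.
  apply: bounded_closed_compact.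
    by exists 1; split => // M M1 a /= ->; exact: ltW.
  apply: (@preimage_closed _ _ (fun a : 'rV[R]_n => `|a|) [set 1]).
    by move=> a _; exact: norm_continuous.
  exact: closed_eq.
(* The open cover is indexed by [D] and by [None], which stands for [- b]. *)
pose side (o : option {classic T}) : 'rV[R]_n :=
  if o is Some x then h x else - b.
pose I := [set o : option {classic T} | if o is Some x then D x else True].
pose U o := [set a : 'rV[R]_n | (side o *m a^T) 0 0 < 0].
have [] : finite_subset_cover I U S.
  move: cS; rewrite compact_cover; apply.
    move=> o _; apply: (open_comp _ (@open_lt R 0)) => a _.
    exact: pairing_continuous.
  move=> a a1; apply: contrapT => naU; apply: noa; exists a^T; split.
  - by rewrite trmx_eq0 -normr_eq0 a1 oner_neq0.
  - move=> x Dx; rewrite leNgt; apply/negP => ax.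
    by apply: naU; exists (Some x).
  - rewrite leNgt; apply/negP => ax.
    by apply: naU; exists None => //; rewrite /U/= mulNmx mxE oppr_lt0.
move=> I' I'I SU; apply: nb.
pose s : seq {classic T} := pmap id (enum_fset I').
pose M := \matrix_(i < size s) h (tnth (in_tuple s) i).
have [[c c0 bE]|[a Ma ba]] := farkas M b.
  exists (size s), (tnth (in_tuple s)), c; split => // i.
  have : tnth (in_tuple s) i \in s by exact: mem_tnth.
  by rewrite mem_pmap map_id => /I'I; rewrite inE.
have a0 : a^T != 0.
  apply: contraTneq ba => /eqP; rewrite trmx_eq0 => /eqP->.
  by rewrite mulmx0 mxE ltxx.
(* The functional given by the Farkas lemma, once normalized, is in no set of
   the finite cover. *)
have /SU[] : S (`|a^T|^-1 *: a^T).
  by rewrite /S /= normrZ normfV normr_id mulVf ?normr_eq0.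
move=> o /= oI'; rewrite /U/= linearZ/= trmxK -scalemxAr mxE.
rewrite pmulr_rlt0 ?invr_gt0 ?normr_gt0//; case: o oI' => [x|] oI' /=.
  have xs : x \in s by rewrite mem_pmap map_id.
  have /tnthP[i ->] : x \in in_tuple s by [].
  have -> : (h (tnth (in_tuple s) i) *m a) 0 0 = (M *m a) i 0.
    by rewrite !mxE; apply: eq_bigr => k _; rewrite !mxE.
  by rewrite ltNge Ma.
by rewrite mulNmx mxE oppr_lt0 ltNge (ltW ba).
Qed.

(** * Independent points *)

(** Caratheodory's reduction.  A linear relation [d] between the vectors of a
    conic combination, with some positive entry, can be subtracted with the
    largest factor [t] that keeps all coefficients nonnegative; then one
    coefficient vanishes, and its point is dropped. *)
Lemma conic_row_free (R : realFieldType) (T : Type) n (D : set T)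
    (h : T -> 'rV[R]_n) b : conic D h b ->
  exists m (x : 'I_m -> T) (c : 'rV[R]_m),
    [/\ forall i, 0 <= c 0 i, b = c *m \matrix_(i < m) h (x i) &
        row_free (\matrix_(i < m) h (x i))].
Proof.
case=> m; elim: m => [|m IH] [x [c [Dx c0 bE]]].
  by exists 0%N, x, c; split => //; rewrite /row_free -leqn0 rank_leq_row.
have [free|] := boolP (row_free (\matrix_(i < m.+1) h (x i))).
  by exists m.+1, x, c.
rewrite -kermx_eq0 => /rowV0Pn[d /sub_kermxP dM d0].
have {d d0 dM} [d dM [k0 dk0]] : exists2 d : 'rV[R]_m.+1,
    d *m \matrix_(i < m.+1) h (x i) = 0 & exists k, 0 < d 0 k.
  have /rV0Pn[k] := d0; rewrite neq_lt => /orP[dk|dk]; last first.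
    by exists d => //; exists k.
  by exists (- d); [rewrite mulNmx dM oppr0|exists k; rewrite mxE oppr_gt0].
have [k dk kmin] : exists2 k, 0 < d 0 k &
    forall i, 0 < d 0 i -> c 0 k / d 0 k <= c 0 i / d 0 i.
  case: (@Order.TotalTheory.arg_minP _ _ _ k0 (fun i => 0 < d 0 i)
    (fun i => c 0 i / d 0 i)) => // k; by exists k.
pose t := c 0 k / d 0 k; pose c' := c - t *: d.
have c'E i : c' 0 i = c 0 i - t * d 0 i by rewrite !mxE.
have c'k : c' 0 k = 0 by rewrite c'E divfK ?subrr// gt_eqF.
apply: IH; exists (x \o lift k), (\row_j c' 0 (lift k j)); split.
- by move=> i; exact: Dx.
- move=> i; rewrite mxE c'E subr_ge0; have [dj|dj] := ltP 0 (d 0 (lift k i)).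
    by rewrite -ler_pdivlMr// kmin.
  by rewrite (le_trans _ (c0 _))// mulr_ge0_le0// divr_ge0// ltW.
- have -> : b = c' *m \matrix_(i < m.+1) h (x i).
    by rewrite mulmxBl -scalemxAl dM scaler0 subr0.
  apply/rowP => j; rewrite !mxE (bigD1_ord k)//= c'k mul0r add0r.
  by apply: eq_bigr => i _; rewrite !mxE.
Qed.

Lemma row_free_point_inj (K : fieldType) (T : Type) m n (h : T -> 'rV[K]_n)
    (x : 'I_m -> T) : row_free (\matrix_(i < m) h (x i)) -> injective x.
Proof.
move=> /row_free_inj free i j xij; apply/eqP; have [//|ij] := eqVneq i j.
have : delta_mx 0 i = delta_mx 0 j :> 'rV[K]_m.
  by apply: free; rewrite -!rowE !rowK xij.
move/rowP/(_ i); rewrite !mxE !eqxx (negbTE ij) => /eqP.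
by rewrite oner_eq0.
Qed.

(** As [m < n], some nonzero [a] is orthogonal to all the rows of values.  By
    independence the function [\sum_i a i *: u i] is not zero, and the row of
    values at a point where it does not vanish is not orthogonal to [a], hence
    independent of the others. *)
Lemma lin_indep_extend (R : realFieldType) (T : Type) n m
    (u : 'I_n -> T -> R^o) (x : 'I_m -> T) : lin_indep u -> (m < n)%N ->
  row_free (\matrix_(i < m) \row_j u j (x i)) ->
  exists y, row_free (col_mx (\matrix_(i < m) \row_j u j (x i)) (\row_j u j y)).
Proof.
move=> indu mn; set M := \matrix_i _ => freeM.
have [a a0 Ma] : exists2 a : 'cV[R]_n, a != 0 & M *m a = 0.
  have : kermx M^T != 0.
    rewrite kermx_eq0 /row_free mxrank_tr ltn_eqF//.
    by rewrite (leq_ltn_trans _ mn)// rank_leq_row.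
  move=> /rowV0Pn[v /sub_kermxP vM v0]; exists v^T; first by rewrite trmx_eq0.
  by rewrite -[M]trmxK -trmx_mul vM trmx0.
have [y ya] : exists y, (\row_j u j y) *m a != 0.
  apply: contrapT => noy; case/eqP: a0; apply/colP => i; rewrite mxE.
  apply: (indu (fun i => a i 0)); apply/funext => y.
  have : (\row_j u j y) *m a = 0.
    by apply: contrapT => /eqP ya; apply: noy; exists y.
  move=> /rowP/(_ 0); rewrite !mxE => s0; rewrite fct_sumE; apply: etrans s0.
  by apply: eq_bigr => j _; rewrite mxE mulrC.
exists y; apply: inj_row_free => c; rewrite -(hsubmxK c).
move: (lsubmx c) (rsubmx c) => c1 c2; rewrite mul_row_col => cM.
have c2E : c2 = 0.
  have /eqP : (c1 *m M + c2 *m (\row_j u j y)) *m a = 0 by rewrite cM mul0mx.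
  rewrite mulmxDl -!mulmxA Ma mulmx0 add0r (mx11_scalar c2) mul_scalar_mx.
  by rewrite scaler_eq0 (negbTE ya) orbF => /eqP ->; rewrite raddf0.
move: cM; rewrite c2E mul0mx addr0 => /eqP; rewrite mulmx_free_eq0// => /eqP ->.
by rewrite row_mx0.
Qed.

(** Adding points of weight zero, as long as their values stay independent,
    turns a conic combination over [m] points into one over exactly [n] points.
    Independence of the values also forces the points to be distinct. *)
Lemma pad_conic (R : realFieldType) (T : Type) n m
    (u : 'I_n -> T -> R^o) (x : 'I_m -> T) (c : 'rV[R]_m) :
  lin_indep u -> (forall i, 0 <= c 0 i) ->
  row_free (\matrix_(i < m) \row_j u j (x i)) ->
  exists (y : 'I_n -> T) (w : 'rV[R]_n),
    [/\ injective y, forall i, 0 <= w 0 i &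
      c *m \matrix_(i < m) (\row_j u j (x i)) =
      w *m \matrix_(i < n) (\row_j u j (y i))].
Proof.
move=> indu c0 free.
have mn : (m <= n)%N by rewrite -(eqP free) rank_leq_col.
have [k nE] : exists k, n = (k + m)%N by exists (n - m)%N; rewrite subnK.
elim: k => [|k IH] in m x c c0 free mn nE *.
  subst n; exists x, c; split => //.
  exact: (@row_free_point_inj R T _ _ (fun t => \row_j u j t)).
have mn' : (m < n)%N by rewrite nE addSn ltnS leq_addl.
have [y free'] := lin_indep_extend indu mn' free.
pose x' (i : 'I_(m + 1)) :=
  match fintype.split i with inl j => x j | inr _ => y end.
have x'E : \matrix_(i < m + 1) (\row_j u j (x' i)) =
    col_mx (\matrix_(i < m) \row_j u j (x i)) (\row_j u j y).
  apply/matrixP => i j; rewrite !mxE /x'.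
  by case: fintype.split => l; rewrite !mxE.
have [||||y' [w [y'i w0 wE]]] := IH (m + 1)%N x' (row_mx c 0).
- by move=> i; rewrite mxE; case: fintype.split => l //; rewrite mxE.
- by rewrite x'E.
- by rewrite nE addn1 addSn ltnS leq_addl.
- by rewrite nE addn1 addnS addSn.
exists y', w; split => //.
by rewrite -wE x'E mul_row_col mul0mx addr0.
Qed.


(** * The vector of integrals lies in the cone of values *)

Section integral_in_cone.
Context (R : realType) (d : measure_display) (Omega : measurableType d).
Variable mu : {measure set Omega -> \bar R}.

Lemma Rintegral_linear_comb n (h : 'I_n -> Omega -> R) (a : 'I_n -> R) D :
  measurable D -> (forall i, mu.-integrable D (EFin \o h i)) ->
  mu.-integrable D (EFin \o (fun t => \sum_(i < n) a i * h i t)) /\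
  \int[mu]_(t in D) (\sum_(i < n) a i * h i t) =
  \sum_(i < n) a i * \int[mu]_(t in D) h i t.
Proof.
move=> mD; elim: n h a => [|n IH] h a ih.
  have -> : EFin \o (fun t => \sum_(i < 0) a i * h i t) = cst 0%E.
    by apply/funext => t /=; rewrite big_ord0.
  under eq_Rintegral do rewrite big_ord0.
  rewrite big_ord0; split; first exact: integrable0.
  by rewrite /Rintegral integral0.
have [i1 E1] := IH (fun i => h (lift ord0 i)) (fun i => a (lift ord0 i))
  (fun i => ih _).
have i0 : mu.-integrable D (EFin \o (fun t => a ord0 * h ord0 t)).
  exact: (@integrableZl _ _ _ mu D mD (a ord0) (EFin \o h ord0) (ih _)).
split.
  have -> : EFin \o (fun t => \sum_(i < n.+1) a i * h i t) =
      (EFin \o (fun t => a ord0 * h ord0 t)) \+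
      (EFin \o (fun t => \sum_(i < n) a (lift ord0 i) * h (lift ord0 i) t)).
    by apply/funext => t /=; rewrite big_ord_recl.
  exact: (@integrableD _ _ _ mu D mD _ _ i0 i1).
under eq_Rintegral do rewrite big_ord_recl.
by rewrite RintegralD// RintegralZl// E1 big_ord_recl.
Qed.

Lemma Rintegral_le0_null (D : set Omega) (g : Omega -> R) :
  measurable D -> mu.-integrable D (EFin \o g) -> (forall t, D t -> 0 <= g t) ->
  \int[mu]_(t in D) g t <= 0 ->
  exists N, [/\ measurable N, mu N = 0%E & forall t, (D `\` N) t -> g t = 0].
Proof.
move=> mD ig g0 Ig.
have [+ _] := ae_eq_integral_abs mu mD (measurable_int mu ig).
case.
  under eq_integral => t /set_mem Dt do rewrite /= ger0_norm ?g0//.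
  rewrite -(@fineK _ (\int[mu]_(t in D) (g t)%:E)%E); last first.
    exact: integrable_fin_num.
  by congr EFin; apply/eqP; rewrite eq_le Ig/=; apply: Rintegral_ge0.
move=> N [mN muN0 gN]; exists N; split => // t [Dt Nt].
by apply: contrapT => gt0; apply: Nt; apply: gN => /= /(_ Dt) [].
Qed.

(** Induction on the number of functions.  Otherwise a nonzero [a] weakly
    separates the vector of integrals from the cone, and [\sum_i a i * h i] is
    zero outside a null set [N].  If [a k] is not zero, the induction hypothesis
    for the functions other than [h k] on [D `\` N] yields points and weights.
    They are also right for [h k], since both the vector of integrals and the
    values at points of [D `\` N] are orthogonal to [a]. *)
Lemma integral_in_cone n (h : 'I_n -> Omega -> R) D :
  measurable D -> (forall i, mu.-integrable D (EFin \o h i)) ->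
  conic D (fun t => \row_i h i t) (\row_i \int[mu]_(t in D) h i t).
Proof.
elim: n h D => [|n IH] h D mD ih; apply: contrapT => /[dup] noncone;
  move=> /conic_separation[a [a0]].
  by case/eqP: a0; apply/colP; case.
have pairing (v : 'rV[R]_n.+1) : (v *m a) 0 0 = \sum_i a i 0 * v 0 i.
  by rewrite mxE; apply: eq_bigr => i _; rewrite mulrC.
move=> ha; rewrite pairing; under eq_bigr do rewrite mxE.
have {}ha t : D t -> 0 <= \sum_i a i 0 * h i t.
  by move=> /ha; rewrite pairing; under eq_bigr do rewrite mxE.
have [ig <-] := Rintegral_linear_comb (fun i => a i 0) mD ih.
move=> /(Rintegral_le0_null mD ig ha)[N [mN muN0 gN]].
have mDN : measurable (D `\` N) by exact: measurableD.
have ihN i : mu.-integrable (D `\` N) (EFin \o h i).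
  by apply: integrableS (ih i) => //; exact: subDsetl.
have intN i : \int[mu]_(t in D) h i t = \int[mu]_(t in D `\` N) h i t.
  by congr fine; exact: (negligible_integral mN mD (ih i) muN0).
have /cV0Pn[k ak] := a0.
have [m [x [c [Dx c0 /rowP cE]]]] :=
  IH (fun i => h (lift k i)) _ mDN (fun i => ihN _).
apply: noncone; exists m, x, c; split => [i||]; [by case: (Dx i)|by []|].
set b := (X in X = _); set M := \matrix_i _.
have Ma : M *m a = 0.
  apply/colP => i; rewrite [RHS]mxE -(gN _ (Dx i)) mxE; apply: eq_bigr => j _.
  by rewrite !mxE mulrC.
have ba : b *m a = 0.
  apply/rowP => i; rewrite ord1 pairing mxE; under eq_bigr do rewrite mxE intN.
  have [_ <-] := Rintegral_linear_comb (fun i => a i 0) mDN ihN.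
  rewrite /Rintegral integral0_eq// => t Dt; congr EFin; exact: gN.
apply/eqP; rewrite -subr_eq0; apply/eqP/rowP => j; rewrite [RHS]mxE.
have off i : (b - c *m M) 0 (lift k i) = 0.
  have := cE i; rewrite !mxE intN => ->; apply/eqP; rewrite subr_eq0; apply/eqP.
  by apply: eq_bigr => l _; rewrite !mxE.
case: (unliftP k j) => [i|] -> //.
have : ((b - c *m M) *m a) 0 0 = 0.
  by rewrite mulmxBl -mulmxA Ma mulmx0 ba subrr mxE.
rewrite pairing (bigD1_ord k)//= big1 ?addr0 => [/eqP|i _]; last first.
  by rewrite off mulr0.
by rewrite mulf_eq0 (negbTE ak) => /eqP.
Qed.

End integral_in_cone.

(** * Quadrature on a space of integrable functions *)

Section quadrature.
Context (R : realType) (d : measure_display) (Omega : measurableType d).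
Variable mu : {measure set Omega -> \bar R}.

(** This is Tchakaloff's theorem; [conic_row_free] and [pad_conic] bring the
    number of nodes to the dimension of the space of functions. *)
Lemma tchakaloff n (u : 'I_n -> Omega -> R^o) :
  lin_indep u -> (forall i, mu.-integrable setT (EFin \o u i)) ->
  exists (x : 'I_n -> Omega) (w : 'I_n -> R),
    [/\ injective x, forall j, 0 <= w j &
      forall h : Omega -> R, lin (range u) h ->
        \int[mu]_t h t = \sum_(j < n) w j * h (x j)].
Proof.
move=> indu intu.
have [m [y [c [c0 intE free]]]] :=
  conic_row_free (integral_in_cone measurableT intu).
have [x [w [xinj w0 wE]]] := pad_conic indu c0 free.
exists x, (w 0); split => // h /lin_rangeP[a ->].
have uE t : (\sum_(i < n) a i *: u i) t = \sum_(i < n) a i * u i t.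
  by rewrite fct_sumE.
under eq_Rintegral do rewrite uE.
have [_ ->] := Rintegral_linear_comb a measurableT intu.
under [RHS]eq_bigr do rewrite uE mulr_sumr.
rewrite exchange_big; apply: eq_bigr => i _.
move: intE; rewrite wE => /rowP/(_ i); rewrite !mxE => ->.
by rewrite mulr_sumr; apply: eq_bigr => j _; rewrite !mxE mulrCA.
Qed.

Lemma mul_Lfun2_integrable (f g : Omega -> R) :
  f \in Lfun mu 2%:E -> g \in Lfun mu 2%:E ->
  mu.-integrable setT (EFin \o (fun t => f t * g t)).
Proof. by move=> f2 g2; exact/Lfun1_integrable/Lfun2_mul_Lfun1. Qed.

Lemma Lfun2_le (f g : Omega -> R) : measurable_fun setT f ->
  measurable_fun setT g -> (forall t, `|f t| <= `|g t|) ->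
  finite_norm mu 2%:E g -> f \in Lfun mu 2%:E.
Proof.
move=> mf mg fg g2; rewrite inE; apply/andP; split; rewrite inE//=.
apply: le_lt_trans g2; rewrite unlock gt0_ler_poweR//.
- by rewrite in_itv/= leey integral_ge0.
- by rewrite in_itv/= leey integral_ge0.
have mpow (h : Omega -> R) : measurable_fun setT h ->
    measurable_fun setT (fun t => `|h t| `^ 2).
  move=> mh.
  apply/(@measurableT_comp _ _ _ _ _ _ (fun x : R => x `^ 2)%R) => //.
  exact/measurableT_comp.
apply: ge0_le_integral => //.
- by move=> t _; exact: poweR_ge0.
- exact/measurable_EFinP/mpow.
- exact/measurable_EFinP/mpow.
- by move=> t _ /=; rewrite lee_fin ge0_ler_powR// nnegrE.
Qed.

Lemma complex_L2_Re_Im (f : Omega -> R[i]) : complex_L2 mu f ->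
  (fun t => complex.Re (f t)) \in Lfun mu 2%:E /\
  (fun t => complex.Im (f t)) \in Lfun mu 2%:E.
Proof.
move=> [mRe mIm f2].
have mnorm : measurable_fun setT (fun t => Normc.normc (f t)).
  have -> : (fun t => Normc.normc (f t)) =
      Num.sqrt \o (fun t => complex.Re (f t) ^+ 2 + complex.Im (f t) ^+ 2).
    by apply/funext => t /=; case: (f t).
  apply: measurableT_comp.
    exact: (continuous_measurable_fun (@sqrt_continuous R)).
  by apply: measurable_funD; exact: measurable_funX.
split; apply: (Lfun2_le _ mnorm) => // t; case: (f t) => a b /=;
  rewrite [leRHS]ger0_norm ?sqrtr_ge0// -sqrtr_sqr ler_wsqrtr//.
  by rewrite lerDl sqr_ge0.
by rewrite lerDr sqr_ge0.
Qed.

End quadrature.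

(** * Real and imaginary parts of spans *)

Section complexification.
Context (R : realType) (T : Type).
Local Notation C := R[i].
Implicit Types (z : T -> C^o).

Definition complexify (b : T -> R^o) : T -> C^o :=
  fun t => real_complex R (b t).

Definition re_part z : T -> R^o := fun t => complex.Re (z t).
Definition im_part z : T -> R^o := fun t => complex.Im (z t).

Lemma ReD (x y : C) : complex.Re (x + y) = complex.Re x + complex.Re y.
Proof. by case: x y => ? ? []. Qed.

Lemma ImD (x y : C) : complex.Im (x + y) = complex.Im x + complex.Im y.
Proof. by case: x y => ? ? []. Qed.

Lemma Re_sum n (F : 'I_n -> C) :
  complex.Re (\sum_(i < n) F i) = \sum_(i < n) complex.Re (F i).
Proof.
by rewrite (big_morph (@complex.Re R) ReD (erefl : complex.Re (0 : C) = 0)).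
Qed.

Lemma Im_sum n (F : 'I_n -> C) :
  complex.Im (\sum_(i < n) F i) = \sum_(i < n) complex.Im (F i).
Proof.
by rewrite (big_morph (@complex.Im R) ImD (erefl : complex.Im (0 : C) = 0)).
Qed.

Lemma Re_mulr (x : C) (r : R) :
  complex.Re (x * real_complex R r) = complex.Re x * r.
Proof. by case: x => x y /=; rewrite mulr0 subr0. Qed.

Lemma Im_mulr (x : C) (r : R) :
  complex.Im (x * real_complex R r) = complex.Im x * r.
Proof. by case: x => x y /=; rewrite mulr0 add0r. Qed.

Lemma conjc_mulJ (x y : C) : conjc (x * conjc y) = y * conjc x.
Proof. by rewrite [LHS]rmorphM/= [conjc (conjc y)]conjcK mulrC. Qed.

Lemma parts_linear_comb n (a : 'I_n -> C) (b : 'I_n -> T -> R^o) :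
  let z := \sum_(i < n) a i *: complexify (b i) in
  re_part z = \sum_(i < n) complex.Re (a i) *: b i /\
  im_part z = \sum_(i < n) complex.Im (a i) *: b i.
Proof.
split; apply/funext => t; rewrite /re_part /im_part !fct_sumE.
  by rewrite Re_sum; apply: eq_bigr => i _; exact: Re_mulr.
by rewrite Im_sum; apply: eq_bigr => i _; exact: Im_mulr.
Qed.

Lemma lin_indep_complexify n (b : 'I_n -> T -> R^o) :
  lin_indep b -> lin_indep (complexify \o b).
Proof.
move=> indb a az i; have [] := parts_linear_comb a b; rewrite /= az => re0 im0.
rewrite [a i]complexE (indb (fun i => complex.Re (a i))).
  by rewrite (indb (fun i => complex.Im (a i))) ?mulr0 ?addr0// -im0.
by rewrite -re0.
Qed.

(** This reduces membership in a complex span, and integration over it, to the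
    real span of the same real functions. *)
Lemma lin_complexifyP n (b : 'I_n -> T -> R^o) z :
  lin (range (complexify \o b)) z <->
  lin (range b) (re_part z) /\ lin (range b) (im_part z).
Proof.
split=> [/lin_rangeP[a ->]|[/lin_rangeP[a aE] /lin_rangeP[c cE]]].
  have [-> ->] := parts_linear_comb a b.
  by split; apply/lin_rangeP; eexists.
apply/lin_rangeP; exists (fun i => Complex (a i) (c i)).
have [reE imE] := parts_linear_comb (fun i => Complex (a i) (c i)) b.
apply/funext => t; apply/eqP; rewrite eq_complex; apply/andP; split; apply/eqP.
  exact: (congr1 (fun g => g t) (etrans aE (esym reE))).
exact: (congr1 (fun g => g t) (etrans cE (esym imE))).
Qed.

End complexification.

(** * Quadrature on products *)

Lemma sum_succ n : (\sum_(j < n) j.+1 = 'C(n.+1, 2))%N.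
Proof.
elim: n => [|n IH]; first by rewrite big_ord0.
by rewrite big_ord_recr/= IH [RHS]binS bin1.
Qed.

Section quadrature_on_products.
Context (R : realType) (d : measure_display) (Omega : measurableType d).
Variable mu : {measure set Omega -> \bar R}.

Lemma real_quadrature n (V : set (Omega -> R^o)) :
  subspace_of_dim n V ->
  (forall f : Omega -> R, V f -> f \in Lfun mu 2%:E) ->
  exists N : nat,
    [/\ subspace_of_dim N
          (lin [set h : Omega -> R^o | exists f g : Omega -> R,
             [/\ V f, V g & h = fun t => f t * g t]]),
        (N <= 'C(n.+1, 2))%N &
        exists (x : 'I_N -> Omega) (w : 'I_N -> R),
          [/\ injective x,
              forall j, 0 <= w j &
              forall f g : Omega -> R, V f -> V g ->
                \int[mu]_t (f t * g t) =
                \sum_(j < N) w j * (f (x j) * g (x j))]].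
Proof.
move=> [f [_ VE]] V2; set P := [set h | _].
have Vf i : V (f i) by rewrite VE; apply: lin_id; exists i.
pose pr i j : Omega -> R^o := fun t => f i t * f j t.
(* One product for each pair [i <= j] gives the binomial bound. *)
pose s := [seq pr i j | j : 'I_n <- enum 'I_n,
  i <- [seq widen_ord (ltn_ord j) i | i <- enum 'I_j.+1]].
have size_s : size s = 'C(n.+1, 2).
  rewrite size_allpairs_dep -sum_succ sumnE big_map big_enum/=.
  by apply: eq_bigr => j _; rewrite size_map size_enum_ord.
have s_pr h : h \in s -> exists i j, h = pr i j.
  by move=> /allpairsPdep[j [i [_ _ ->]]]; exists i, j.
have pr_s (i j : 'I_n) : (i <= j)%N -> pr i j \in s.
  move=> ij; apply/allpairsPdep; exists j, i; split => //.
    exact: mem_enum.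
  apply/mapP; exists (Ordinal (ij : i < j.+1)%N); first exact: mem_enum.
  exact: val_inj.
have [N [b [Ns indb bs sb]]] := exists_basis s.
have spanP g h : V g -> V h -> lin (range b) (fun t => g t * h t).
  rewrite VE => Vg Vh.
  apply: (@mul_span R Omega (@idfun R) n f) => // i j.
  have [ij|/ltnW ji] := leqP i j; first exact/sb/pr_s.
  have -> : (fun t => f i t * idfun (f j t)) = pr j i.
    by apply/funext => t; rewrite mulrC.
  exact/sb/pr_s.
have intb i : mu.-integrable setT (EFin \o b i).
  have [k [l ->]] := s_pr _ (bs i).
  by apply: mul_Lfun2_integrable; exact: V2.
have [x [w [xinj w0 quad]]] := tchakaloff indb intb.
exists N; split; [|by rewrite -size_s|]; last first.
  by exists x, w; split => // g h Vg Vh; apply/quad/spanP.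
exists b; split => //; apply/seteqP; split; apply: sub_lin.
  by move=> _ [g [h [Vg Vh ->]]]; exact: spanP.
move=> _ [i _ <-]; apply: lin_id; have [k [l ->]] := s_pr _ (bs i).
by exists (f k), (f l).
Qed.

Lemma complex_quadrature n (V : set (Omega -> R[i]^o)) :
  subspace_of_dim n V ->
  (forall f : Omega -> R[i], V f -> complex_L2 mu f) ->
  exists N : nat,
    [/\ subspace_of_dim N
          (lin [set h : Omega -> R[i]^o | exists f g : Omega -> R[i],
             [/\ V f, V g & h = fun t => f t * conjc (g t)]]),
        (N <= n ^ 2)%N &
        exists (x : 'I_N -> Omega) (w : 'I_N -> R),
          [/\ injective x,
              forall j, 0 <= w j &
              forall f g : Omega -> R[i], V f -> V g ->
                complex_integral mu (fun t => f t * conjc (g t)) =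
                \sum_(j < N)
                  real_complex R (w j) * (f (x j) * conjc (g (x j)))]].
Proof.
move=> [f [_ VE]] V2; set P := [set h | _].
have Vf i : V (f i) by rewrite VE; apply: lin_id; exists i.
pose pr i j : Omega -> R[i]^o := fun t => f i t * conjc (f j t).
(* Exchanging [i] and [j] conjugates [pr i j], and [pr i i] is real, so among
   the [2 * n ^ 2] real and imaginary parts one for each pair [(i, j)] is enough
   up to sign. *)
pose part (i j : 'I_n) : Omega -> R^o :=
  if (i <= j)%N then re_part (pr i j) else im_part (pr i j).
pose s := [seq part i j | i <- enum 'I_n, j <- enum 'I_n].
have size_s : size s = (n ^ 2)%N.
  by rewrite size_allpairs size_enum_ord mulnn.
have s_part h : h \in s -> exists i j, h = part i j.
  by move=> /allpairsP[[i j] [_ _ ->]]; exists i, j.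
have part_s i j : part i j \in s.
  by apply/allpairsP; exists (i, j); split; rewrite ?mem_enum.
have re_sym i j : re_part (pr i j) = re_part (pr j i).
  apply/funext => t; rewrite /re_part /pr.
  by case: (f i t) (f j t) => a b [c e] /=; ring.
have im_asym i j : im_part (pr i j) = - im_part (pr j i).
  apply/funext => t; rewrite fctE /im_part /pr.
  by case: (f i t) (f j t) => a b [c e] /=; ring.
have [N [b [Ns indb bs sb]]] := exists_basis s.
have re_b i j : lin (range b) (re_part (pr i j)).
  wlog ij : i j / (nat_of_ord i <= j)%N => [H|].
    by have [/H//|/ltnW/H] := leqP i j; rewrite re_sym.
  by have := sb _ (part_s i j); rewrite /part ij.
have im_b i j : lin (range b) (im_part (pr i j)).
  have imlt (k l : 'I_n) : (l < k)%N -> lin (range b) (im_part (pr k l)).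
    by move=> lk; have := sb _ (part_s k l); rewrite /part leqNgt lk.
  case: (ltngtP i j) => [ij|/imlt//|ij].
    by rewrite im_asym -scaleN1r; apply: linZ; exact: imlt.
  have -> : im_part (pr i j) = 0; last exact: lin0.
  apply/funext => t; rewrite /im_part /pr (val_inj ij).
  by case: (f j t) => a c /=; rewrite mulrN mulrC addNr.
have spanP g h : V g -> V h ->
    lin (range (@complexify R Omega \o b)) (fun t => g t * conjc (h t)).
  rewrite VE => Vg Vh; apply: (@mul_span R[i] Omega (@conjc R) n f) => // i j.
  by apply/lin_complexifyP; split; [exact: re_b|exact: im_b].
have parts2 i := complex_L2_Re_Im (V2 _ (Vf i)).
have intb i : mu.-integrable setT (EFin \o b i).
  have [k [l ->]] := s_part _ (bs i).
  have [[rk ik] [rl il]] := (parts2 k, parts2 l).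
  rewrite /part; case: ifP => _.
    have -> : EFin \o re_part (pr k l) =
      (EFin \o (fun t => complex.Re (f k t) * complex.Re (f l t))) \+
      (EFin \o (fun t => complex.Im (f k t) * complex.Im (f l t))).
      apply/funext => t; rewrite /re_part /pr /=.
      by case: (f k t) (f l t) => a c [e g] /=; rewrite -EFinD mulrN opprK.
    by apply: integrableD => //; apply: mul_Lfun2_integrable.
  have -> : EFin \o im_part (pr k l) =
    ((EFin \o (fun t => complex.Im (f k t) * complex.Re (f l t))%R) \-
    (EFin \o (fun t => complex.Re (f k t) * complex.Im (f l t))%R))%E.
    apply/funext => t; rewrite /im_part /pr /=.
    by case: (f k t) (f l t) => a c [e g] /=; rewrite -EFinB mulrN addrC.
  by apply: integrableB => //; apply: mul_Lfun2_integrable.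
have [x [w [xinj w0 quad]]] := tchakaloff indb intb.
exists N; split; [|by rewrite -size_s|].
  exists (@complexify R Omega \o b); split; first exact: lin_indep_complexify.
  apply/seteqP; split; apply: sub_lin.
    by move=> _ [g [h [Vg Vh ->]]]; exact: spanP.
  move=> _ [i _ <-].
  have Ppr k l : lin P (pr k l) by apply: lin_id; exists (f k), (f l).
  have [k [l /= ->]] := s_part _ (bs i); rewrite /part; case: ifP => _.
    have -> : complexify (re_part (pr k l)) = 2^-1 *: (pr k l + pr l k).
      apply/funext => t; rewrite /complexify /re_part ReJ_add mulrC.
      by congr (_ * (_ + _)); exact: conjc_mulJ.
    by apply: linZ; apply: linD.
  have -> : complexify (im_part (pr k l)) =
      (Complex 0 1 / 2) *: (pr l k + - 1 *: pr k l).
    apply/funext => t; rewrite /complexify /im_part ImJ_sub mulrC mulrA mulrAC.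
    rewrite scaleN1r; congr (_ * (_ + _)).
    by rewrite conjc_mulJ.
  by apply: linZ; apply: linD => //; apply: linZ.
exists x, w; split => // g h Vg Vh.
have /lin_complexifyP[/quad reE /quad imE] := spanP g h Vg Vh.
apply/eqP; rewrite eq_complex /complex_integral.
apply/andP; split; apply/eqP => /=.
  rewrite [LHS]reE Re_sum; apply: eq_bigr => j _.
  by rewrite [in RHS]mulrC Re_mulr mulrC.
rewrite [LHS]imE Im_sum; apply: eq_bigr => j _.
by rewrite [in RHS]mulrC Im_mulr mulrC.
Qed.

End quadrature_on_products.

Theorem theorem5p2 (R : realType) (d : measure_display)
    (Omega : measurableType d) (mu : {measure set Omega -> \bar R}) (n : nat) :
  (* K = R *)
  (forall V : set (Omega -> R^o),
     subspace_of_dim n V ->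
     (forall f : Omega -> R, V f -> f \in Lfun mu 2%:E) ->
     exists N : nat,
       [/\ subspace_of_dim N
             (lin [set h : Omega -> R^o | exists f g : Omega -> R,
                [/\ V f, V g & h = fun t => f t * g t]]),
           (N <= 'C(n.+1, 2))%N &
           exists (x : 'I_N -> Omega) (w : 'I_N -> R),
             [/\ injective x,
                 forall j, 0 <= w j &
                 forall f g : Omega -> R, V f -> V g ->
                   \int[mu]_t (f t * g t) =
                   \sum_(j < N) w j * (f (x j) * g (x j))]])
  /\
  (* K = C *)
  (forall V : set (Omega -> R[i]^o),
     subspace_of_dim n V ->
     (forall f : Omega -> R[i], V f -> complex_L2 mu f) ->
     exists N : nat,
       [/\ subspace_of_dim N
             (lin [set h : Omega -> R[i]^o | exists f g : Omega -> R[i],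
                [/\ V f, V g & h = fun t => f t * conjc (g t)]]),
           (N <= n ^ 2)%N &
           exists (x : 'I_N -> Omega) (w : 'I_N -> R),
             [/\ injective x,
                 forall j, 0 <= w j &
                 forall f g : Omega -> R[i], V f -> V g ->
                   complex_integral mu (fun t => f t * conjc (g t)) =
                   \sum_(j < N)
                     real_complex R (w j) * (f (x j) * conjc (g (x j)))]]).
Proof.
by split=> V; [exact: real_quadrature|exact: complex_quadrature].
Qed.
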